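(* Let $R$ be a ring, let $\mathcal{X}$ be a class of right $R$-modules closed under isomorphisms, and let $M$ be a right $R$-module with an epimorphic $\mathcal{X}$-cover $p:X\to M$ such that $\mathrm{End}(X)/J(\mathrm{End}(X))$ is a von Neumann regular right self-injective ring and idempotents lift modulo $J(\mathrm{End}(X))$. Let $M$ be $\mathcal{X}$-automorphism-coinvariant and assume that every direct summand of $M$ has an $\mathcal{X}$-cover. Then $M$ is a clean module.
   Context: Rings are associative with identity, modules are unital right modules, $J(-)$ is the Jacobson radical. An $\mathcal{X}$-precover of $M$ is a homomorphism $p:X\to M$ with $X\in\mathcal{X}$ such that every homomorphism $X'\to M$ with $X'\in\mathcal{X}$ factors through $p$. It is an $\mathcal{X}$-cover if, moreover, every endomorphism $h$ of $X$ with $p\circ h=p$ is an automorphism; it is epimorphic if $p$ is an epimorphism. $M$ is $\mathcal{X}$-automorphism-coinvariant if there is an $\mathcal{X}$-cover $p:X\to M$ such that for every automorphism $g$ of $X$ there is an endomorphism $f$ of $M$ with $f\circ p=p\circ g$. A ring is clean if each of its elements is the sum of an idempotent and a unit; a module $M$ is clean if $\mathrm{End}(M)$ is a clean ring. *)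

(* Defs.v *)
From HB Require Import structures.
From mathcomp Require Import all_boot all_algebra.
From mathcomp Require Import boolp classical_sets.

Set Implicit Arguments.
Unset Strict Implicit.
Unset Printing Implicit Defensive.

Import GRing.Theory.

Local Open Scope ring_scope.
Local Open Scope quotient_scope.
Local Open Scope classical_set_scope.

(* Rings are [pzRingType]s, so the zero ring is allowed: it occurs as the
   endomorphism ring of the zero module.  A right R-module is an
   [lmodType R^c]: [a *: x] stands for x a.  The choice structure packed in an
   [lmodType] is no restriction, since boolp provides one on every type. *)
Notation rmodType R := (lmodType R^c).

Section EndomorphismRing.
Variables (T : pzRingType) (M : lmodType T).

Definition endo : Type := {linear M -> M}.

HB.instance Definition _ := gen_eqMixin endo.
HB.instance Definition _ := gen_choiceMixin endo.

Implicit Types f g h : endo.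

Lemma endo_ext f g : (forall x, f x = g x) -> f = g.
Proof.
case: f g => [f [[[cf1 cf2]] [cf3]]] [g [[[cg1 cg2]] [cg3]]] /= fg.
have {fg} fg : f = g by apply: funext.
case: _ / fg in cg1 cg2 cg3 *.
by rewrite (Prop_irrelevance cg1 cf1) (Prop_irrelevance cg2 cf2)
  (Prop_irrelevance cg3 cf3).
Qed.

Definition endo_zero : endo := \0 : {linear M -> M}.
Definition endo_opp f : endo := \- f : {linear M -> M}.
Definition endo_add f g : endo := f \+ g : {linear M -> M}.
Definition endo_one : endo := idfun : {linear M -> M}.
Definition endo_mul f g : endo := f \o g : {linear M -> M}.

Lemma endo_addA : associative endo_add.
Proof. by move=> f g h; apply: endo_ext => x; apply: addrA. Qed.

Lemma endo_addC : commutative endo_add.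
Proof. by move=> f g; apply: endo_ext => x; apply: addrC. Qed.

Lemma endo_add0 : left_id endo_zero endo_add.
Proof. by move=> f; apply: endo_ext => x; apply: add0r. Qed.

Lemma endo_addN : left_inverse endo_zero endo_opp endo_add.
Proof. by move=> f; apply: endo_ext => x; apply: addNr. Qed.

HB.instance Definition _ :=
  GRing.isZmodule.Build endo endo_addA endo_addC endo_add0 endo_addN.

Lemma endo_mulA : associative endo_mul.
Proof. by move=> f g h; apply: endo_ext. Qed.

Lemma endo_mul1l : left_id endo_one endo_mul.
Proof. by move=> f; apply: endo_ext. Qed.

Lemma endo_mul1r : right_id endo_one endo_mul.
Proof. by move=> f; apply: endo_ext. Qed.

Lemma endo_mulDl : left_distributive endo_mul +%R.
Proof. by move=> f g h; apply: endo_ext. Qed.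

Lemma endo_mulDr : right_distributive endo_mul +%R.
Proof. by move=> f g h; apply: endo_ext => x; apply: (raddfD f). Qed.

HB.instance Definition _ := GRing.Zmodule_isPzRing.Build endo
  endo_mulA endo_mul1l endo_mul1r endo_mulDl endo_mulDr.

End EndomorphismRing.

Section JacobsonRadical.
Variable S : pzRingType.

Definition right_ideal (I : set S) : Prop :=
  [/\ I 0, forall x y, I x -> I y -> I (x + y) & forall x a, I x -> I (x * a)].

Definition maximal_right_ideal (I : set S) : Prop :=
  [/\ right_ideal I, I <> setT
    & forall K, right_ideal K -> I `<=` K -> K = I \/ K = setT].

Definition jacobson_radical : set S :=
  \bigcap_(I in [set I | maximal_right_ideal I]) I.

Lemma right_idealB (I : set S) x y : right_ideal I -> I x -> I y -> I (x - y).
Proof.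
by move=> [_ ID IM] Ix Iy; apply: ID => //; rewrite -mulrN1; apply: IM.
Qed.

Lemma jacobson_mulr x a : jacobson_radical x -> jacobson_radical (x * a).
Proof. by move=> Jx I mI; case: (mI) => -[_ _ IM] _ _; apply: IM; apply: Jx. Qed.

(* For a maximal right ideal I and a notin I, {y | a y \in I} is again a
   maximal right ideal. *)
Lemma jacobson_mull a x : jacobson_radical x -> jacobson_radical (a * x).
Proof.
move=> Jx I mI; case: (mI) => rI IT Imax; case: (rI) => I0 ID IM.
have [Ia|nIa] := pselect (I a); first exact: IM.
apply: (Jx [set y | I (a * y)]); split.
- split=> [|y z /= Iy Iz|y b /= Iy]; first by rewrite /= mulr0.
    by rewrite mulrDr; apply: ID.
  by rewrite mulrA; apply: IM.
- by move/seteqP => -[_ /(_ 1 Logic.I)] /=; rewrite mulr1.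
move=> K rK IK; case: (rK) => K0 KD KM.
have [KI|nKI] := pselect (K `<=` [set y | I (a * y)]).
  by left; apply/seteqP; split.
right; have [k Kk nIk] : exists2 k, K k & ~ I (a * k).
  by apply: contrapT => nk; apply: nKI => k Kk; apply: contrapT => ?; apply: nk;
    exists k.
pose L : set S := [set z | exists m s, I m /\ z = m + a * k * s].
have rL : right_ideal L.
  split=> [|_ _ [m [s [Im ->]]] [n [t [In ->]]]|_ b [m [s [Im ->]]]].
  - by exists 0, 0; rewrite mulr0 addr0.
  - by exists (m + n), (s + t); split; [apply: ID|rewrite mulrDr addrACA].
  - by exists (m * b), (s * b); split; [apply: IM|rewrite mulrDl !mulrA].
have IL : I `<=` L by move=> m Im; exists m, 0; rewrite mulr0 addr0.
have Lak : L (a * k) by exists 0, 1; rewrite add0r mulr1.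
case: (Imax L rL IL) => LE; first by rewrite LE in Lak.
have [m [s [Im am]]] : L a by rewrite LE.
have K1 : K 1.
  rewrite -(subrK (k * s) 1); apply: KD; last exact: KM.
  apply: IK => /=; rewrite mulrBr mulr1 mulrA [X in X - _]am addrK //.
by apply/seteqP; split=> // y _; rewrite -(mul1r y); apply: KM.
Qed.

Definition jacobson_pred : {pred S} := fun x => `[< jacobson_radical x >].

Lemma jacobson_zmod_closed : zmod_closed jacobson_pred.
Proof.
split=> [|x y /asboolP Jx /asboolP Jy]; apply/asboolP => I mI.
  by case: (mI) => -[].
by apply: right_idealB; [case: mI|apply: Jx|apply: Jy].
Qed.

HB.instance Definition _ :=
  GRing.isZmodClosed.Build S jacobson_pred jacobson_zmod_closed.

(* The library only makes quotients by ideals of commutative rings into rings;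
   the additive quotient is reused and the multiplication is added here. *)
Definition jacobson_quot : Type := Quotient.quot jacobson_pred.

HB.instance Definition _ := GRing.Zmodule.on jacobson_quot.
HB.instance Definition _ := EqQuotient.on jacobson_quot.

Lemma jacobson_quot_eq (x y : S) :
  (\pi_jacobson_quot x = \pi_jacobson_quot y) <-> jacobson_radical (x - y).
Proof.
split=> [/eqP|J]; first by rewrite -Quotient.idealrBE => /asboolP.
by apply/eqP; rewrite -Quotient.idealrBE; apply/asboolP.
Qed.

Definition jacobson_quot_one : jacobson_quot := \pi_jacobson_quot 1.
Definition jacobson_quot_mul (x y : jacobson_quot) : jacobson_quot :=
  \pi_jacobson_quot (repr x * repr y).

Lemma jacobson_pi_mul (x y : S) :
  jacobson_quot_mul (\pi_jacobson_quot x) (\pi_jacobson_quot y) =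
  \pi_jacobson_quot (x * y).
Proof.
apply/jacobson_quot_eq.
set x' := repr _; set y' := repr _.
have Jx : jacobson_radical (x' - x) by apply/jacobson_quot_eq; rewrite reprK.
have Jy : jacobson_radical (y' - y) by apply/jacobson_quot_eq; rewrite reprK.
have -> : x' * y' - x * y = (x' - x) * y' + x * (y' - y).
  by rewrite mulrBl mulrBr addrA subrK.
move=> I mI; case: (mI) => -[_ ID _] _ _; apply: ID.
  exact: (jacobson_mulr y' Jx).
exact: (jacobson_mull x Jy).
Qed.

Lemma jacobson_pi_add (x y : S) :
  \pi_jacobson_quot x + \pi_jacobson_quot y = \pi_jacobson_quot (x + y).
Proof. exact: esym (Quotient.pi_add _ x y). Qed.

Lemma jacobson_pi_surj (x : jacobson_quot) : exists a, x = \pi_jacobson_quot a.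
Proof. by exists (repr x); rewrite reprK. Qed.

Lemma jacobson_quot_mulA : associative jacobson_quot_mul.
Proof.
move=> x y z; have [[a ->] [b ->] [c ->]] :=
  And3 (jacobson_pi_surj x) (jacobson_pi_surj y) (jacobson_pi_surj z).
rewrite (jacobson_pi_mul b c) (jacobson_pi_mul a b).
by rewrite (jacobson_pi_mul a) (jacobson_pi_mul _ c) mulrA.
Qed.

Lemma jacobson_quot_mul1l : left_id jacobson_quot_one jacobson_quot_mul.
Proof.
by move=> x; have [a ->] := jacobson_pi_surj x; rewrite jacobson_pi_mul mul1r.
Qed.

Lemma jacobson_quot_mul1r : right_id jacobson_quot_one jacobson_quot_mul.
Proof.
by move=> x; have [a ->] := jacobson_pi_surj x; rewrite jacobson_pi_mul mulr1.
Qed.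

Lemma jacobson_quot_mulDl : left_distributive jacobson_quot_mul +%R.
Proof.
move=> x y z; have [[a ->] [b ->] [c ->]] :=
  And3 (jacobson_pi_surj x) (jacobson_pi_surj y) (jacobson_pi_surj z).
rewrite (jacobson_pi_add a b) (jacobson_pi_mul a c) (jacobson_pi_mul b c).
by rewrite (jacobson_pi_mul _ c) (jacobson_pi_add (a * c)) mulrDl.
Qed.

Lemma jacobson_quot_mulDr : right_distributive jacobson_quot_mul +%R.
Proof.
move=> x y z; have [[a ->] [b ->] [c ->]] :=
  And3 (jacobson_pi_surj x) (jacobson_pi_surj y) (jacobson_pi_surj z).
rewrite (jacobson_pi_add b c) (jacobson_pi_mul a b) (jacobson_pi_mul a c).
by rewrite (jacobson_pi_mul a) (jacobson_pi_add (a * b)) mulrDr.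
Qed.

HB.instance Definition _ := GRing.Zmodule_isPzRing.Build jacobson_quot
  jacobson_quot_mulA jacobson_quot_mul1l jacobson_quot_mul1r
  jacobson_quot_mulDl jacobson_quot_mulDr.

End JacobsonRadical.

Section RingProperties.
Variable S : pzRingType.

Definition von_neumann_regular : Prop :=
  forall a : S, exists b : S, a = a * b * a.

Definition injective_module (E : rmodType S) : Prop :=
  forall (A B : rmodType S) (i : {linear A -> B}) (f : {linear A -> E}),
    injective i -> exists g : {linear B -> E}, forall a, g (i a) = f a.

(* (S^c)^o is S acting on itself on the right: [a *: x] is [x * a] in S. *)
Definition right_self_injective : Prop := injective_module (S^c)^o.

Definition idempotents_lift_mod_jacobson : Prop :=
  forall x : S, jacobson_radical (x * x - x) ->
    exists e : S, e * e = e /\ jacobson_radical (e - x).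

(* [GRing.unit] is not available here, as it needs decidable inverses. *)
Definition is_unit (u : S) : Prop := exists v : S, u * v = 1 /\ v * u = 1.

Definition clean_ring : Prop :=
  forall a : S, exists e u : S, [/\ e * e = e, is_unit u & a = e + u].

End RingProperties.

Arguments von_neumann_regular S : clear implicits.
Arguments right_self_injective S : clear implicits.
Arguments idempotents_lift_mod_jacobson S : clear implicits.
Arguments clean_ring S : clear implicits.

Section Covers.
Variable R : pzRingType.
Implicit Types (M N K X : rmodType R) (cX : rmodType R -> Prop).

Definition clean_module M : Prop := clean_ring (endo M).

Definition closed_under_iso cX : Prop :=
  forall (A B : rmodType R) (f : {linear A -> B}), bijective f -> cX A -> cX B.

Definition is_precover cX X M (p : {linear X -> M}) : Prop :=
  cX X /\
  forall (X' : rmodType R) (q : {linear X' -> M}), cX X' ->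
    exists h : {linear X' -> X}, forall x, p (h x) = q x.

Definition is_cover cX X M (p : {linear X -> M}) : Prop :=
  is_precover cX p /\
  forall h : {linear X -> X}, (forall x, p (h x) = p x) -> bijective h.

Definition epimorphic X M (p : {linear X -> M}) : Prop :=
  forall m, exists x, p x = m.

Definition has_cover cX M : Prop :=
  exists (X : rmodType R) (p : {linear X -> M}), is_cover cX p.

Definition automorphism_coinvariant cX M : Prop :=
  exists (X : rmodType R) (p : {linear X -> M}), is_cover cX p /\
    forall g : {linear X -> X}, bijective g ->
      exists f : {linear M -> M}, forall x, f (p x) = p (g x).

(* N is isomorphic to a direct summand of M. *)
Definition direct_summand N M : Prop :=
  exists (K : rmodType R) (phi : {linear (N * K)%type -> M}), bijective phi.

End Covers.

(* Main.v *)
(** Let S = End(X).  Every automorphism of X, and every endomorphism of M, is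
    related by p to an endomorphism of the other module, so End(M) is a quotient
    of a subring T of S containing all units of S.  If S is clean, so is T: in
    a = e + u with a in T, the unit u lies in T, hence so does e.  Since units
    and idempotents lift modulo J(S), it remains to see that a regular right
    self-injective ring Q is clean.

    Given g in Q, let V be maximal among the right ideals on which g is
    injective and which satisfy V \cap gV = 0.  By injectivity Q is a direct sum
    V + gV + Y, and by maximality the component h of g on Y maps every y in Y
    into yQ.  Then Y = ker h + hY, h being bijective on hY, so h - f is
    invertible on Y for the projection f onto ker h along hY.  Along V + gV + Y,
    where gV is identified with V through g,
      g = [0 a b; 1 c d; 0 r h]   and   e = [0 a-1 bf; 0 1 0; 0 (1-f)r f],
    e is idempotent, and g - e is invertible. *)

Require Import Defs.
From HB Require Import structures.
From mathcomp Require Import all_boot all_algebra.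
From mathcomp Require Import boolp classical_sets.

Set Implicit Arguments.
Unset Strict Implicit.
Unset Printing Implicit Defensive.

Import GRing.Theory.

Local Open Scope ring_scope.
Local Open Scope quotient_scope.
Local Open Scope classical_set_scope.

Section RightIdealModule.
Context {S : pzRingType}.
Implicit Types V : {I : set S | right_ideal I}.

Definition right_ideal_pred V : {pred (S^c)^o} := fun x => `[< sval V x >].

Lemma right_ideal_pred_submod V : submod_closed (right_ideal_pred V).
Proof.
have [I0 IA IM] := svalP V; split=> [|a x y /asboolP Ix /asboolP Iy].
  exact/asboolP.
by apply/asboolP; apply: IA => //; apply: IM.
Qed.

HB.instance Definition _ V :=
  GRing.isSubmodClosed.Build S^c (S^c)^o (right_ideal_pred V)
    (right_ideal_pred_submod V).

Record right_ideal_module V := RightIdealModule {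
  ideal_val :> (S^c)^o;
  _ : ideal_val \in right_ideal_pred V }.

HB.instance Definition _ V := [isSub for @ideal_val V].
HB.instance Definition _ V := [Choice of right_ideal_module V by <:].
HB.instance Definition _ V :=
  [SubChoice_isSubLmodule of right_ideal_module V by <:].

Lemma ideal_valP V (x : right_ideal_module V) : sval V (ideal_val x).
Proof. by apply: asboolW; case: x. Qed.

End RightIdealModule.

Section SelfInjective.
Variable S : pzRingType.
Hypothesis inj : right_self_injective S.

Lemma self_injective_mul (A : rmodType S) (i f : A -> (S^c)^o) :
  linear i -> linear f -> (forall x, i x = 0 -> x = 0) ->
  exists q : S, forall x, q * (i x : S) = f x.
Proof.
move=> li lf i0.
pose i_l : {linear A -> (S^c)^o} :=
  HB.pack i (GRing.isLinear.Build _ _ _ _ i li).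
pose f_l : {linear A -> (S^c)^o} :=
  HB.pack f (GRing.isLinear.Build _ _ _ _ f lf).
have ii : injective i_l.
  move=> x y xy; apply/eqP; rewrite -subr_eq0; apply/eqP/i0.
  have -> : i (x - y) = i_l x - i_l y by rewrite -[LHS]/(i_l (x - y)) linearB.
  by rewrite xy subrr.
have [g gi] :
    exists g : {linear (S^c)^o -> (S^c)^o}, forall a, g (i_l a) = f_l a.
  exact: inj ii.
exists (g 1 : S) => x; rewrite -[RHS](gi x).
have -> : i_l x = (i x : S^c) *: (1 : (S^c)^o) by apply/esym/(mul1r (i x : S)).
by rewrite linearZ.
Qed.

Lemma split_projections (V : set S) (g : S) :
  right_ideal V -> (forall x y, V x -> V y -> x = g * y -> y = 0) ->
  exists q1 q2 : S, forall x, V x ->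
    [/\ q1 * x = x, q1 * (g * x) = 0, q2 * x = 0 & q2 * (g * x) = x].
Proof.
move=> rV Vg; case: (rV) => V0 _ VM.
pose A : rmodType S := right_ideal_module (exist _ V rV).
pose vl (x : A) : S := ideal_val x.
pose i (z : A * A) : (S^c)^o := vl z.1 + g * vl z.2.
have li : linear i.
  move=> a x y; rewrite /i.
  have vD (u v : A) : vl (a *: u + v) = vl u * a + vl v by [].
  by rewrite [(a *: x + y).1]/= [(a *: x + y).2]/= !vD mulrDr addrACA mulrA
    -mulrDl.
have i0 z : i z = 0 -> z = 0.
  case: z => x y; rewrite /i /= => /eqP; rewrite addr_eq0 => /eqP xy.
  have VN z : V z -> V (- z) by move=> Vz; rewrite -mulrN1; apply: VM.
  have y0 : vl y = 0.
    apply: (Vg (- vl x) _ _ (ideal_valP y)).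
      by apply: VN; apply: (ideal_valP x).
    by rewrite xy opprK.
  have x0 : vl x = 0 by rewrite xy y0 mulr0 oppr0.
  by congr pair; apply: val_inj.
have [q1 q1E] := @self_injective_mul (A * A)%type i (fun z => vl z.1) li
  (fun a z t => erefl) i0.
have [q2 q2E] := @self_injective_mul (A * A)%type i (fun z => vl z.2) li
  (fun a z t => erefl) i0.
exists q1, q2 => x Vx.
pose y : A := @RightIdealModule S (exist _ V rV) x (asboolT Vx).
have i1 : i (y, 0) = x by rewrite /i /= mulr0 addr0.
have i2 : i (0, y) = g * x by rewrite /i /= add0r.
split.
- by rewrite -[X in q1 * X]i1 q1E.
- by rewrite -[X in q1 * X]i2 q1E.
- by rewrite -[X in q2 * X]i1 q2E.
- by rewrite -[X in q2 * X]i2 q2E.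
Qed.

End SelfInjective.

Lemma mul_rwl (S : pzRingType) (a b c : S) :
  a * b = c -> forall z, a * (b * z) = c * z.
Proof. by move=> <- z; rewrite mulrA. Qed.

(* [P1], [g * k], [P3] are the projections onto V, gV, Y and [k] inverts
   [g : V -> gV]; [w'] is the inverse of [h - f] on Y. *)
Lemma clean_blocks (S : pzRingType) (g k P1 P3 f w' : S) :
  P1 * P1 = P1 -> P1 * k = k -> k * P1 = 0 -> k * (g * P1) = P1 ->
  k * (g * k) = k -> P1 * (g * P1) = 0 -> P1 * (g * k) = 0 ->
  P1 * P3 = 0 -> k * P3 = 0 -> P3 * P1 = 0 ->
  P3 * (g * P1) = 0 -> P3 * (g * k) = 0 -> P1 + g * k + P3 = 1 ->
  f * f = f -> P3 * f = f -> f * P3 = f ->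
  P3 * w' = w' -> w' * P3 = w' -> f * w' = - f -> w' * f = - f ->
  (P3 * g * P3 - f) * w' = P3 -> w' * (P3 * g * P3 - f) = P3 ->
  exists e u : S, [/\ e * e = e, is_unit u & g = e + u].
Proof.
move=> P11 P1k kP1 kgP1 kgk P1gP1 P1gk P13 kP3 P31 P3gP1 P3gk one ff Pf fP Pw wP
  fw wf ww1 ww2.
have P3k : P3 * k = 0 by rewrite -P1k mulrA P31 mul0r.
have P33 : P3 * P3 = P3.
  by rewrite -[RHS]mulr1 -one !mulrDr P31 P3gk !add0r.
have kk : k * k = 0 by rewrite -{2}P1k mulrA kP1 mul0r.
have kf : k * f = 0 by rewrite -Pf mulrA kP3 mul0r.
have fP1 : f * P1 = 0 by rewrite -fP -mulrA P31 mulr0.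
have fk : f * k = 0 by rewrite -fP -mulrA P3k mulr0.
have fgk : f * (g * k) = 0 by rewrite -fP -mulrA P3gk mulr0.
have P1f : P1 * f = 0 by rewrite -Pf mulrA P13 mul0r.
have [X XE] : exists X, X = P1 - P1 * (g * ((P3 - f) * w')) by eexists.
have [Y YE] : exists Y, Y = w' + f * (g * (g * X))
    by eexists.
have [v vE] : exists v, v = k - k * (g * (g * X)) + X - k * (g * Y)
    by eexists.
have [u' u'E] : exists u', u' = v + g * X + Y
    by eexists.
have [e eE] : exists e, e = P1 * (g * (g * k)) - k + (P3 - f) * (g * (g * k)) +
  g * k + (P1 * (g * f) + f)
    by eexists.
have ee : e * e = e.
  have [n nE] : exists n, n = P1 * (g * (g * k)) - k + (P3 - f) * (g * (g * k))
    by eexists.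
  rewrite -nE in eE.
  have nP1 : n * P1 = 0
    by rewrite nE !mulrDl !mulNr -!mulrA kP1 !mulr0 oppr0 !addr0.
  have nf : n * f = 0
    by rewrite nE !mulrDl !mulNr -!mulrA kf !mulr0 oppr0 !addr0.
  have ngk : n * (g * k) = n by rewrite nE !mulrDl !mulNr -!mulrA kgk.
  have fn : f * n = 0
    by rewrite nE !mulrDr !mulrN !mulrA fP1 fk !mulrBr fP ff subrr !mul0r oppr0
      !addr0.
  have kn : k * n = 0
    by rewrite nE !mulrDr !mulrN !mulrA kP1 kk !mulrBr kP3 kf subrr !mul0r oppr0
      !addr0.
  have nn : n * n = 0
    by rewrite {1}nE !mulrDl !mulNr -!mulrA kn !mulr0 oppr0 !addr0.
  have E := (kn, fn, nn, nf, ngk, mul_rwl nP1, kf, kgk, mul_rwl kP1, mul_rwl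
    fP1, ff, mul_rwl ff, fgk, mul0r, mulr0, add0r, addr0).
  by rewrite eE !mulrDl !mulrDr -!mulrA !E.
have [u uE] : exists u, u = g - e by eexists.
have ku : k * u = k * g - k.
  rewrite uE eE mulrBr !mulrDr mulrN !mulrBl !mulrBr.
  have E := (kk, kf, kgk, mul_rwl kP1, mul_rwl kP3, mul_rwl kf, mul0r, mulr0,
    add0r, addr0, oppr0).
  by rewrite !E.
have P1u : P1 * u = k + P1 * (g * (P3 - f)).
  have E := (P1f, P1k, P1gk, mul_rwl P11, mul_rwl P13, mul_rwl P1f, mul0r,
    mulr0, add0r, addr0, oppr0).
  have -> : P1 * u = P1 * g - (P1 * (g * (g * k)) - k + P1 * (g * f)).
    by rewrite uE eE mulrBr !mulrDr mulrN !mulrBl !mulrBr !E.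
  rewrite -[in X in X - _](mulr1 g) -one !mulrDr !mulrN P1gP1 add0r.
  rewrite !opprD opprK [LHS]addrACA.
  by rewrite addNKr.
have P3u : P3 * u = f * (g * (g * k)) + (P3 * g * P3 - f).
  have E := (P3k, P33, Pf, P3gk, mul_rwl P31, mul_rwl P33, mul_rwl Pf, mul0r,
    mulr0, add0r, addr0, oppr0).
  have -> : P3 * u = P3 * g - (P3 * (g * (g * k)) - f * (g * (g * k)) + f).
    by rewrite uE eE mulrBr !mulrDr mulrN !mulrBl !mulrBr !E.
  rewrite -{1}[g]mulr1 -one !mulrDr P3gP1 add0r !opprD opprK addrACA.
  by rewrite addNKr -[P3 * g * P3]mulrA.
have kv : k * v = 0.
  by rewrite vE !(mulrDr, mulrN) !(mul_rwl kk) kk XE !(mulrDr, mulrN) kP1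
    (mul_rwl kP1) !(mul0r, oppr0, addr0).
have kX : k * X = 0
  by rewrite XE !(mulrDr, mulrN) kP1 (mul_rwl kP1) !(mul0r, oppr0, addr0).
have P1X : P1 * X = X by rewrite XE mulrBr P11 (mul_rwl P11).
have kgX : k * (g * X) = X.
  by rewrite -[in LHS]P1X (mulrA g) mulrA kgP1.
have P3X : P3 * X = 0 by rewrite -P1X mulrA P31 mul0r.
have P1v : P1 * v = v.
  by rewrite vE !(mulrDr, mulrN) P1X P1k !(mul_rwl P1k).
have kgv : k * (g * v) = v by rewrite -[in LHS]P1v (mulrA g) mulrA kgP1.
have P3v : P3 * v = 0 by rewrite -P1v mulrA P31 mul0r.
have P3gX : P3 * (g * X) = 0 by rewrite -P1X (mulrA g) mulrA P3gP1 mul0r.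
have P1gX : P1 * (g * X) = 0 by rewrite -P1X (mulrA g) mulrA P1gP1 mul0r.
have P3Y : P3 * Y = Y by rewrite YE mulrDr Pw (mul_rwl Pf).
have kY : k * Y = 0 by rewrite -P3Y mulrA kP3 mul0r.
have P1Y : P1 * Y = 0 by rewrite -P3Y mulrA P13 mul0r.
have ku' : k * u' = X by rewrite u'E !mulrDr kv kgX kY add0r addr0.
have P3u' : P3 * u' = Y by rewrite u'E !mulrDr P3v P3gX P3Y !add0r.
have fu' : f * u' = f * Y by rewrite -{1}fP -mulrA P3u'.
have fY : (P3 - f) * Y = (P3 - f) * w'.
  rewrite YE mulrDr [X in _ + X]mulrBl (mul_rwl Pf) (mul_rwl ff) subrr addr0 //.
have uu' : u * u' = 1.
  have h1 : P1 * (u * u') = P1.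
    have fu'w : (P3 - f) * u' = (P3 - f) * w'
      by rewrite -fY !mulrBl P3u' fu' P3Y.
    rewrite mulrA P1u mulrDl ku' -!mulrA fu'w.
    by rewrite XE subrK.
  have h2 : k * (u * u') = k.
    rewrite mulrA ku mulrBl ku' -mulrA u'E !mulrDr kgv.
    rewrite [v + _ + _]addrAC [in v + _]vE subrK.
    by rewrite addrAC addrK subrK.
  have h3 : P3 * (u * u') = P3.
    rewrite mulrA P3u mulrDl.
    have -> : (P3 * g * P3 - f) * u' = (P3 * g * P3 - f) * Y.
      by rewrite !mulrBl fu' -!mulrA P3u' P3Y.
    rewrite {1}YE mulrDr ww1 [X in _ + (_ + X)]mulrA.
    have -> : (P3 * g * P3 - f) * f = - f.
      have {2}-> : f = w' * - f by rewrite mulrN wf opprK.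
      by rewrite mulrA ww1 mulrN Pf.
    by rewrite mulNr -!mulrA ku' addrCA subrr addr0.
  by rewrite -[LHS]mul1r -one !mulrDl h1 h3 -mulrA h2.
have u_inj z : u * z = 0 -> z = 0.
  move=> uz.
  have k0 : k * (g * z) - k * z = 0
    by rewrite mulrA -mulrBl -ku -mulrA uz mulr0.
  have P30 : f * (g * (g * (k * z))) + (P3 * g * P3 - f) * z = 0.
    by rewrite -[RHS](mulr0 P3) -uz (mulrA P3 u) P3u [RHS]mulrDl !mulrA.
  have P10 : k * z + P1 * (g * ((P3 - f) * z)) = 0.
    by rewrite -[RHS](mulr0 P1) -uz (mulrA P1 u) P1u [RHS]mulrDl !mulrA.
  have P3z : P3 * z = f * (g * (g * (k * z))).
    have := congr1 (fun t => w' * t) P30.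
    rewrite mulr0 mulrDr (mul_rwl ww2) (mul_rwl wf) mulNr => /eqP.
    by rewrite addrC subr_eq0 => /eqP.
  have Pfz : (P3 - f) * z = 0.
    by rewrite mulrBl -[f in X in _ - X]fP -mulrA P3z (mul_rwl ff) subrr.
  have kz : k * z = 0 by move: P10; rewrite Pfz !mulr0 addr0.
  have P3z0 : P3 * z = 0 by rewrite P3z kz !mulr0.
  have zP1 : z = P1 * z.
    by rewrite -[LHS]mul1r -one !mulrDl P3z0 -mulrA kz mulr0 !addr0.
  by move: k0; rewrite kz subr0 zP1 (mulrA g) mulrA kgP1.
have u'u : u' * u = 1.
  by apply/eqP; rewrite -subr_eq0; apply/eqP/u_inj;
    rewrite mulrBr mulr1 mulrA uu' mul1r subrr.
exists e, u; split=> //; first by exists u'.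
by rewrite uE addrC subrK.
Qed.

Lemma cyclic_preserving_corner_clean (S : pzRingType) (P h : S) :
  von_neumann_regular S -> P * P = P -> P * h = h -> h * P = h ->
  (forall y, P * y = y -> exists r, h * y = y * r) ->
  exists f w', [/\ f * f = f, P * f = f & f * P = f] /\
  [/\ P * w' = w', w' * P = w', f * w' = - f & w' * f = - f] /\
  (h - f) * w' = P /\ w' * (h - f) = P.
Proof.
move=> vnr PP Ph hP hy.
have [d [Pd dP hdh]] : exists d, [/\ P * d = d, d * P = d & h * d * h = h].
  have [d hdh] := vnr h; exists (P * d * P).
  by split; rewrite ?mulrA ?PP // ?hP -!mulrA ?PP // Ph mulrA.
have [j jE] : exists j, j = d * h by eexists.
have Pj : P * j = j by rewrite jE mulrA Pd.
have jP : j * P = j by rewrite jE -mulrA hP.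
have hj : h * j = h by rewrite jE mulrA.
have jj : j * j = j by rewrite jE mulrA -(mulrA d h d) -mulrA hdh.
have jh : j * h = h.
  have [r hr] := hy j Pj.
  by rewrite -hj hr mulrA jj.
have [y yE] : exists y, y = j - h * d * j by eexists.
have y0 : y = 0.
  have jy : j * y = y by rewrite yE mulrBr jj !mulrA jh.
  have Py : P * y = y by rewrite -jy mulrA Pj.
  have [r hr] := hy y Py.
  have hdy : h * d * y = 0 by rewrite yE mulrBr !mulrA hdh subrr.
  have hy0 : h * y = 0 by rewrite -[h in LHS]hdh -mulrA hr mulrA hdy mul0r.
  by rewrite -jy jE -mulrA hy0 mulr0.
have hdj : h * d * j = j by apply/esym/eqP; rewrite -subr_eq0 -yE y0.
have [f fE] : exists f, f = P - j by eexists.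
have fj : f * j = 0 by rewrite fE mulrBl Pj jj subrr.
have jf : j * f = 0 by rewrite fE mulrBr jP jj subrr.
have ff : f * f = f by rewrite {1}fE mulrBl jf subr0 fE mulrBr PP Pj.
have Pf : P * f = f by rewrite fE mulrBr PP Pj.
have fP : f * P = f by rewrite fE mulrBl PP jP.
have hf : h * f = 0 by rewrite fE mulrBr hP hj subrr.
have fh : f * h = 0 by rewrite fE mulrBl Ph jh subrr.
exists f, (j * d * j - f); split=> //; split; first split.
- by rewrite mulrBr !mulrA Pj Pf.
- by rewrite mulrBl -!mulrA jP fP.
- by rewrite mulrBr !mulrA fj !mul0r ff sub0r.
- by rewrite mulrBl -!mulrA jf !mulr0 ff sub0r.
split.
  rewrite mulrBl !mulrBr !mulrA hj hdj hf fj ff !mul0r subr0 sub0r opprK.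
  by rewrite fE addrCA subrr addr0.
rewrite mulrBr !mulrBl -!mulrA jh jf fh ff !mulr0 !subr0 sub0r opprK.
by rewrite -jE jj fE addrCA subrr addr0.
Qed.

Lemma annihilator_idempotent (S : pzRingType) (e c : S) :
  von_neumann_regular S -> e * e = e ->
  exists2 e', e' * e' = e' & forall x, e' * x = x <-> e * x = x /\ c * x = 0.
Proof.
move=> vnr ee; have [d dE] := vnr (c * e).
have [e' e'E] : exists e', e' = e - e * d * (c * e) by eexists.
have ee' : e * e' = e' by rewrite e'E mulrBr !mulrA ee.
have ce' : c * e' = 0.
  by rewrite -ee' mulrA e'E mulrBr -(mulrA c) ee !mulrA -{1}(mulrA c e) ee
    -!mulrA {1}dE !mulrA subrr.
have e'x x : e * x = x -> c * x = 0 -> e' * x = x.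
  by move=> ex cx; rewrite e'E mulrBl -!mulrA ex cx !mulr0 subr0.
exists e'; first exact: e'x.
move=> x; split=> [<-|[]]; last exact: e'x.
by rewrite !mulrA ee' ce' mul0r.
Qed.

Lemma regular_self_injective_clean (S : pzRingType) :
  von_neumann_regular S -> right_self_injective S -> clean_ring S.
Proof.
move=> vnr inj g.
pose good (V : set S) := [/\ forall x y, V x -> V y -> V (x + y),
  forall x a, V x -> V (x * a) &
  forall x y, V x -> V y -> x = g * y -> y = 0].
have [V [[VD VM Vg] Vmax]] : exists V, good V /\ forall W, V `<` W -> ~ good W.
  apply: Zorn_bigcup => F Fg Ftot; split.
  - move=> x y [A FA Ax] [B FB By].
    case: (Ftot A B FA FB) => AB; [exists B|exists A] => //.
      by have [D _ _] := Fg B FB; apply: D => //; apply: AB.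
    by have [D _ _] := Fg A FA; apply: D => //; apply: AB.
  - by move=> x a [A FA Ax]; exists A => //; have [_ M _] := Fg A FA; apply: M.
  - move=> x y [A FA Ax] [B FB By] xy.
    case: (Ftot A B FA FB) => AB.
      by have [_ _ I] := Fg B FB; apply: (I x y) => //; apply: AB.
    by have [_ _ I] := Fg A FA; apply: (I x y) => //; apply: AB.
have Vsup W : good W -> V `<=` W -> forall x, W x -> V x.
  move=> gW VW x Wx; apply: contrapT => nVx; apply: (Vmax W) => //.
  by split=> // /(_ x Wx).
have V0 : V 0.
  apply: (Vsup (V `|` [set 0])); [|by left|by right].
  split.
  - move=> x y [Vx|->] [Vy|->]; rewrite ?(addr0, add0r);
      [|by left|by left|by right].
    by left; apply: VD.
  - by move=> x a [Vx|->]; [left; apply: VM|right; rewrite mul0r].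
  - move=> x y Vx' [Vy|->] // xy; apply: (Vg x y) => //.
    by case: Vx' => [//|x0]; rewrite x0 -(mulr0 y); apply: VM.
have rV : right_ideal V by [].
have [q1 [q2 qV]] := split_projections inj rV Vg.
have [e ee eV] : exists2 e, e * e = e & forall x, e * x = x <-> V x.
  have [e1 e11 e1P] := annihilator_idempotent (q1 - 1) vnr (mulr1 (1 : S)).
  have [e2 e22 e2P] := annihilator_idempotent q2 vnr e11.
  have [e3 e33 e3P] := annihilator_idempotent (q1 * g) vnr e22.
  have [e4 e44 e4P] := annihilator_idempotent (q2 * g - 1) vnr e33.
  have e4E x : e4 * x = x <-> [/\ q1 * x = x, q1 * (g * x) = 0,
      q2 * x = 0 & q2 * (g * x) = x].
    rewrite e4P e3P e2P e1P mul1r !mulrBl mul1r -!mulrA; split.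
      by case=> [[[[_ /subr0_eq ->] ->] ->] /subr0_eq ->].
    by case=> -> -> -> ->; rewrite !subrr.
  exists e4 => // x; split; last by move=> Vx; apply/e4E/qV.
  apply: (Vsup (fun x => e4 * x = x)).
    split=> [y z ey ez|y a ey|y z /e4E[ey _ _ _] /e4E[_ gz _ ez] yz].
    - by rewrite mulrDr ey ez.
    - by rewrite mulrA ey.
    - by rewrite -ez -yz -ey yz gz mulr0.
  by move=> y Vy; apply/e4E/qV.
have Ve : V e by apply/eV.
have [q1e q1ge q2e q2ge] := qV e Ve.
have [k kE] : exists k, k = e * q2 by eexists.
have [P1 P1E] : exists P1, P1 = e * q1 by eexists.
have ke : k * e = 0 by rewrite kE -mulrA q2e mulr0.
have kge : k * (g * e) = e by rewrite kE -mulrA q2ge ee.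
have P1e : P1 * e = e by rewrite P1E -mulrA q1e.
have P1ge : P1 * (g * e) = 0 by rewrite P1E -mulrA q1ge mulr0.
have ek : e * k = k by rewrite kE mulrA ee.
have eP1 : e * P1 = P1 by rewrite P1E mulrA ee.
have P11 : P1 * P1 = P1 by rewrite -{2}eP1 mulrA P1e.
have P1k : P1 * k = k by rewrite -ek mulrA P1e.
have kP1 : k * P1 = 0 by rewrite -eP1 mulrA ke mul0r.
have kgP1 : k * (g * P1) = P1 by rewrite -eP1 (mulrA g) mulrA kge.
have kgk : k * (g * k) = k by rewrite -{2}ek (mulrA g) mulrA kge.
have P1gP1 : P1 * (g * P1) = 0 by rewrite -{2}eP1 (mulrA g) mulrA P1ge mul0r.
have P1gk : P1 * (g * k) = 0 by rewrite -ek (mulrA g) mulrA P1ge mul0r.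
have [P3 P3E] : exists P3, P3 = 1 - P1 - g * k by eexists.
have one : P1 + g * k + P3 = 1
  by rewrite P3E -[1 - P1 - _]addrA -opprD addrCA subrr addr0.
have P13 : P1 * P3 = 0 by rewrite P3E !mulrBr mulr1 P11 P1gk subrr subr0.
have kP3 : k * P3 = 0 by rewrite P3E !mulrBr mulr1 kP1 kgk subr0 subrr.
have P3e : P3 * e = 0
  by rewrite P3E !mulrBl mul1r P1e -mulrA ke mulr0 subrr subr0.
have P3ge : P3 * (g * e) = 0.
  by rewrite P3E !mulrBl mul1r P1ge subr0 -mulrA kge subrr.
have P31 : P3 * P1 = 0 by rewrite -eP1 mulrA P3e mul0r.
have P3k : P3 * k = 0 by rewrite -ek mulrA P3e mul0r.
have P3gP1 : P3 * (g * P1) = 0 by rewrite -eP1 (mulrA g) mulrA P3ge mul0r.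
have P3gk : P3 * (g * k) = 0 by rewrite -ek (mulrA g) mulrA P3ge mul0r.
have P33 : P3 * P3 = P3 by rewrite {2}P3E !mulrBr mulr1 P31 P3gk !subr0.
have P3V x : V x -> P3 * x = 0 by move=> /eV <-; rewrite mulrA P3e mul0r.
have P3gV x : V x -> P3 * (g * x) = 0.
  by move=> /eV <-; rewrite (mulrA g) mulrA P3ge mul0r.
have Vk x : V (k * x) by apply/eV; rewrite mulrA ek.
have hy y : P3 * y = y -> exists r, P3 * g * P3 * y = y * r.
  move=> P3y; apply: contrapT => nr.
  have [y' yE] := vnr y; have [i iE] : exists i, i = y * y' by eexists.
  have [c cE] : exists c, c = (1 - i) * (P3 * g * P3 * i)
    by eexists.
  have [d dE] := vnr c.
  have [z zE] : exists z, z = i * (d * c)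
    by eexists.
  have iy : i * y = y by rewrite iE -yE.
  have ii : i * i = i by rewrite {2}iE mulrA iy -iE.
  have P3i : P3 * i = i by rewrite iE mulrA P3y.
  have iz : i * z = z by rewrite zE mulrA ii.
  have P3z : P3 * z = z by rewrite -iz mulrA P3i.
  have ci : c * i = c by rewrite cE -!mulrA ii.
  have cz : c * z = c by rewrite zE mulrA ci mulrA -dE.
  have z_inj r : c * (z * r) = 0 -> z * r = 0.
    by rewrite mulrA cz zE -!mulrA => ->; rewrite !mulr0.
  have z0 : z != 0.
    apply/eqP => z0; apply: nr; exists (y' * (P3 * g * P3 * y)).
    have c0 : c = 0 by rewrite -cz z0 mulr0.
    rewrite mulrA -iE; move: c0; rewrite cE mulrBl mul1r => /subr0_eq hi.
    by rewrite -{1}iy mulrA hi -!mulrA iy.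
  (* [W] is V plus a nonzero piece of Y, shifted by [k * g] along V so that [g]
     maps the shifted piece into V + Y; it contradicts the maximality of V. *)
  pose W x := exists v r, V v /\ x = v + (1 - k * g) * (z * r).
  have P3W v r : V v -> P3 * (v + (1 - k * g) * (z * r)) = z * r.
    move=> Vv; rewrite mulrDr P3V // add0r mulrBl mul1r mulrBr (mulrA P3 z) P3z.
    by rewrite -(mulrA k) (mulrA P3 k) P3k mul0r subr0.
  have P3gW v r : V v -> P3 * (g * (v + (1 - k * g) * (z * r))) =
      P3 * g * P3 * (z * r).
    move=> Vv; rewrite !mulrDr P3gV // add0r mulrBl mul1r !mulrBr.
    by rewrite -[P3 * g * P3 * _]mulrA (mulrA P3 z) P3z -(mulrA k) (P3gV _ (Vk
      _)) subr0 mulrA.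
  have gW : good W.
    split.
    - move=> _ _ [v1 [r1 [V1 ->]]] [v2 [r2 [V2 ->]]].
      by exists (v1 + v2), (r1 + r2); split;
        [apply: VD|rewrite !mulrDr addrACA].
    - move=> _ a [v [r [Vv ->]]].
      by exists (v * a), (r * a); split; [apply: VM|rewrite mulrDl !mulrA].
    - move=> _ _ [v1 [r1 [V1 ->]]] [v2 [r2 [V2 ->]]] E.
      have zr : z * r1 = P3 * g * P3 * (z * r2) by rewrite -(P3W v1) // E P3gW.
      have zr2 : z * r2 = 0.
        apply: z_inj.
        have -> : c * (z * r2) = (1 - i) * (z * r1).
          by rewrite zr cE -!mulrA (mulrA i z) iz.
        by rewrite mulrBl mul1r mulrA iz subrr.
      have zr1 : z * r1 = 0 by rewrite zr zr2 mulr0.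
      by move: E; rewrite zr1 zr2 !mulr0 !addr0; apply: Vg.
  have : V ((1 - k * g) * z).
    apply: (Vsup W gW); first by move=> v Vv; exists v, 0; rewrite !mulr0 addr0.
    by exists 0, 1; rewrite mulr1 add0r.
  move/P3V; rewrite mulrBl mul1r mulrBr P3z -mulrA (mulrA P3) P3k mul0r subr0.
  exact/eqP.
have [f [w' [[ff Pf fP] [[Pw wP fw wf] [ww1 ww2]]]]] :
  exists f w', [/\ f * f = f, P3 * f = f & f * P3 = f] /\
  [/\ P3 * w' = w', w' * P3 = w', f * w' = - f & w' * f = - f] /\
  (P3 * g * P3 - f) * w' = P3 /\ w' * (P3 * g * P3 - f) = P3.
  apply: cyclic_preserving_corner_clean => //; first by rewrite !mulrA P33.
  by rewrite -!mulrA P33.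
exact: (@clean_blocks S g k P1 P3 f w').
Qed.

Lemma maximal_right_ideal_ex (S : pzRingType) (I : set S) :
  right_ideal I -> ~ I 1 -> exists2 K, maximal_right_ideal K & I `<=` K.
Proof.
move=> rI nI1.
pose ok (K : set S) := right_ideal (I `|` K) /\ ~ (I `|` K) 1.
have [K [[rK K1] Kmax]] : exists K, ok K /\ forall L, K `<` L -> ~ ok L.
  apply: Zorn_bigcup => F Fok Ftot.
  have mem x : (I `|` \bigcup_(X in F) X) x -> I x \/ exists2 X, F X & (I `|` X)
    x.
    by case=> [Ix|[X FX Xx]]; [left|right; exists X => //; right].
  have up X x : F X -> (I `|` X) x -> (I `|` \bigcup_(X in F) X) x.
    by move=> FX [Ix|Xx]; [left|right; exists X].
  case: (rI) => I0 ID IM; split; last first.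
    by move=> /mem [//|[X FX]]; have [_] := Fok X FX.
  split; first by left.
  - move=> x y /mem[Ix|[X FX Xx]] /mem[Iy|[Y FY Yy]].
    + by left; apply: ID.
    + by apply: (up Y) => //; have [[_ D _] _] := Fok Y FY; apply: D => //;
        left.
    + by apply: (up X) => //; have [[_ D _] _] := Fok X FX; apply: D => //;
        left.
    + case: (Ftot X Y FX FY) => XY.
        apply: (up Y) => //; have [[_ D _] _] := Fok Y FY; apply: D => //.
        by case: Xx => [Ix|/XY Yx]; [left|right].
      apply: (up X) => //; have [[_ D _] _] := Fok X FX; apply: D => //.
      by case: Yy => [Iy|/XY Xy]; [left|right].
  - move=> x a /mem[Ix|[X FX Xx]]; first by left; apply: IM.
    by apply: (up X) => //; have [[_ _ M] _] := Fok X FX; apply: M.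
exists (I `|` K); last by move=> x Ix; left.
split=> // [IKT|L rL IKL]; first by apply: K1; rewrite IKT.
have [L1|nL1] := pselect (L 1).
  right; apply/seteqP; split=> // x _; rewrite -(mul1r x).
  by case: rL => _ _; apply.
left; apply/seteqP; split=> // x Lx; apply: contrapT => nx.
have IL : I `|` L = L
  by apply/seteqP; split=> [y [Iy|//]|y Ly]; [apply: IKL; left|right].
apply: (Kmax L); last by rewrite /ok IL.
split=> [y Ky|/(_ x Lx) Kx]; first by apply: IKL; right.
by apply: nx; right.
Qed.

Section JacobsonUnits.
Variable S : pzRingType.

Lemma jacobson_right_inverse (a : S) :
  jacobson_radical (a - 1) -> exists b, a * b = 1.
Proof.
move=> Ja; apply: contrapT => nb.
have rI : right_ideal [set x | exists r, x = a * r].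
  split=> [|_ _ [r ->] [s ->]|_ b [r ->]].
  - by exists 0; rewrite mulr0.
  - by exists (r + s); rewrite mulrDr.
  - by exists (r * b); rewrite mulrA.
have [|K mK aK] := maximal_right_ideal_ex rI.
  by case=> r r1; apply: nb; exists r.
have [rK KT _] := mK; have [_ _ KM] := rK.
have K1 : K 1.
  rewrite -(subKr a 1); apply: right_idealB => //; last exact: Ja.
  by apply: aK; exists 1; rewrite mulr1.
by apply: KT; apply/seteqP; split=> // x _; rewrite -(mul1r x); apply: KM.
Qed.

Lemma jacobson_unit (a : S) : jacobson_radical (a - 1) -> is_unit a.
Proof.
move=> Ja; have [b ab] := jacobson_right_inverse Ja.
have [|c bc] := @jacobson_right_inverse b.
  have -> : b - 1 = (a - 1) * (- b) by rewrite mulrN mulrBl ab mul1r opprB.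
  exact: jacobson_mulr.
by exists b; split=> //; have -> : a = c
  by rewrite -[a]mulr1 -bc mulrA ab mul1r.
Qed.

Lemma jacobson_quot_unit (a : S) :
  is_unit (\pi_(jacobson_quot S) a) -> is_unit a.
Proof.
case=> v; have [b ->] := jacobson_pi_surj v.
case=> /(etrans (esym (jacobson_pi_mul _ _))) /jacobson_quot_eq ab.
move=> /(etrans (esym (jacobson_pi_mul _ _))) /jacobson_quot_eq ba.
have [c [abc _]] := jacobson_unit ab; have [d [_ dba]] := jacobson_unit ba.
have E : b * c = d * b by rewrite -[RHS]mulr1 -abc !mulrA -(mulrA d) dba mul1r.
by exists (b * c); rewrite mulrA abc E -mulrA dba.
Qed.

Lemma clean_lift_jacobson :
  idempotents_lift_mod_jacobson S -> clean_ring (jacobson_quot S) ->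
  clean_ring S.
Proof.
move=> lift clQ a.
have [e0 [u0 [ee0 uu0 aE]]] := clQ (\pi_(jacobson_quot S) a).
have [x xE] := jacobson_pi_surj e0.
have [|e [ee /jacobson_quot_eq ex]] := lift x.
  by apply/jacobson_quot_eq; rewrite -xE -[RHS]ee0 xE;
    apply/esym/jacobson_pi_mul.
exists e, (a - e); split=> //; last by rewrite addrC subrK.
apply: jacobson_quot_unit; have -> // : \pi_(jacobson_quot S) (a - e) = u0.
apply: (addrI e0); rewrite -aE xE -ex.
by rewrite (jacobson_pi_add e (a - e)) addrC subrK.
Qed.

End JacobsonUnits.

Section Coinvariance.
Variables (R : pzRingType) (cX : rmodType R -> Prop).
Implicit Types M X : rmodType R.

Lemma cover_iso M X X' (p : {linear X -> M}) (p' : {linear X' -> M}) :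
  is_cover cX p -> is_cover cX p' ->
  exists h : {linear X -> X'}, bijective h /\ forall x, p' (h x) = p x.
Proof.
move=> [[cXX pX] pb] [[cXX' pX'] pb'].
have [h hE] := pX' X p cXX; have [h' h'E] := pX X' p' cXX'.
exists h; split=> //.
have [g gK Kg] := pb (h' \o h : {linear X -> X}) (fun x => etrans (h'E _) (hE
  x)).
have [g' g'K Kg'] := pb' (h \o h' : {linear X' -> X'}) (fun x => etrans (hE _)
  (h'E x)).
exists (g \o h') => x; first exact: gK.
have -> : x = h (h' (g' x)) by rewrite [RHS]Kg'.
by congr (h _); rewrite /= -[RHS]gK.
Qed.

Lemma coinvariant_cover M X (p : {linear X -> M}) (g : {linear X -> X}) :
  is_cover cX p -> automorphism_coinvariant cX M -> bijective g ->
  exists f : {linear M -> M}, forall x, f (p x) = p (g x).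
Proof.
move=> cp [X' [p' [cp' coinv]]] gb.
have [h [[h' hK Kh] hE]] := cover_iso cp cp'.
have lh' := can2_linear hK Kh.
pose h'l : {linear X' -> X} := HB.pack h' (GRing.isLinear.Build _ _ _ _ h' lh').
pose g' : {linear X' -> X'} := h \o (g \o h'l).
have [|f fE] := coinv g'.
  by apply: bij_comp; [exists h'|apply: bij_comp => //; exists h].
by exists f => x; rewrite -!hE fE /= hK.
Qed.

Lemma is_unit_bijective X (u : endo X) :
  is_unit u -> bijective (u : {linear X -> X}).
Proof.
case=> v [uv vu]; exists (v : {linear X -> X}) => x.
  by rewrite -[LHS]/((v * u : endo X) x) vu.
by rewrite -[LHS]/((u * v : endo X) x) uv.
Qed.

Lemma coinvariant_clean M X (p : {linear X -> M}) :
  is_cover cX p -> epimorphic p -> automorphism_coinvariant cX M ->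
  clean_module X -> clean_module M.
Proof.
move=> cp pe coinv clX phi.
have [[cXX pX] _] := cp.
have [s sE] := pX X (phi \o p : {linear X -> M}) cXX.
have [e [u [ee uu su]]] := clX s.
have [v [uv vu]] := uu.
have uv' : is_unit v by exists u.
have [fu fuE] := coinvariant_cover cp coinv (is_unit_bijective uu).
have [fv fvE] := coinvariant_cover cp coinv (is_unit_bijective uv').
pose psi : endo M := phi - (fu : endo M).
exists psi, (fu : endo M).
have pE (f g : endo M) : (forall x, f (p x) = g (p x)) -> f = g.
  by move=> fg; apply: endo_ext => m; have [x <-] := pe m.
have eE x : psi (p x) = p (e x).
  rewrite -[LHS]/(phi (p x) - fu (p x)) fuE -[phi _]sE -linearB; congr (p _).
  by rewrite su; apply: (addrK (u x) (e x)).
split; last by rewrite /psi subrK.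
- apply: pE => x; rewrite -[LHS]/(psi (psi (p x))).
  by rewrite !eE -{3}ee.
- exists (fv : endo M); split; apply: pE => x.
    by rewrite -[LHS]/(fu (fv (p x))) fvE fuE -[X in p X]/((u * v : endo X) x)
      uv.
  by rewrite -[LHS]/(fv (fu (p x))) fuE fvE -[X in p X]/((v * u : endo X) x) vu.
Qed.

End Coinvariance.

Theorem theorem4p11 (R : pzRingType) (cX : rmodType R -> Prop)
    (cX_iso : closed_under_iso cX)
    (M X : rmodType R) (p : {linear X -> M})
    (p_cover : is_cover cX p) (p_epi : epimorphic p)
    (regular : von_neumann_regular (jacobson_quot (endo X)))
    (self_injective : right_self_injective (jacobson_quot (endo X)))
    (lift : idempotents_lift_mod_jacobson (endo X))
    (M_coinv : automorphism_coinvariant cX M)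
    (summands : forall N : rmodType R, direct_summand N M -> has_cover cX N) :
  clean_module M.
Proof.
apply: (coinvariant_clean p_cover) => //; apply: clean_lift_jacobson => //.
exact: regular_self_injective_clean.
Qed.
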